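(* Let $c_1\ge c_2>0$, $c_3>0$, $0\le v<c_2$, and let $Q_*>0$, $\mathcal P_1,\mathcal P_2\in\mathbb R$. Let $u,w:\mathbb R\to\mathbb R$ be continuously differentiable functions that form a steady-state splitting solution of the continuous two-string model, i.e. $$(c_1^2-v^2)u''(\eta)-c_3^2\big(u(\eta)-w(\eta)\big)=0,\qquad (c_2^2-v^2)w''(\eta)+c_3^2\big(u(\eta)-w(\eta)\big)=0\qquad(\eta>0),$$ $$u''(\eta)=w''(\eta)=0\qquad(\eta<0),$$ such that $Q(\eta)=w(\eta)-u(\eta)$ stays bounded as $\eta\to+\infty$, $Q(0)=Q_*$, and $c_1^2u'(\eta)=\mathcal P_1$, $c_2^2w'(\eta)=\mathcal P_2$ for $\eta<0$. Then $$\frac{\mathcal P_1}{c_1^2}-\frac{\mathcal P_2}{c_2^2}=\nu Q_*,\qquad \nu=c_3\sqrt{\frac{c_1^2+c_2^2-2v^2}{(c_1^2-v^2)(c_2^2-v^2)}},$$ and the common strain at infinity $A_0=\lim_{\eta\to+\infty}u'(\eta)=\lim_{\eta\to+\infty}w'(\eta)$ exists and equals $$A_0=\frac{1}{c_1^2+c_2^2-2v^2}\left[\mathcal P_1\left(1-\frac{v^2}{c_1^2}\right)+\mathcal P_2\left(1-\frac{v^2}{c_2^2}\right)\right].$$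
   Context: The model: two elastic strings with displacements $u$ (string 1, wave speed $c_1$) and $w$ (string 2, wave speed $c_2$), connected for $\eta>0$ by distributed elastic bonds of stiffness $c_3^2$ and separated for $\eta<0$, where $\eta=x-vt$ and $v$ is the splitting speed. $\mathcal P_1,\mathcal P_2$ are the tensile forces in the separated strings, and $Q_*$ is the critical bond strain, reached at the splitting point $\eta=0$. *)

(* Defs.v *)
(* Real analysis over Stdlib's R, with Coquelicot's derivatives and limits. *)
From Stdlib Require Export Reals.
From Coquelicot Require Export Coquelicot.
Open Scope R_scope.

Definition continuously_differentiable (f : R -> R) : Prop :=
  forall x : R, ex_derive f x /\ continuous (Derive f) x.

(* [Derive_n] is a total function, so the equations are only meaningful together
   with [ex_derive_n], which asserts that the second derivatives exist. They are
   not required at the splitting point 0, where u'' and w'' may jump. *)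
Definition bonded_equations (c1 c2 c3 v : R) (u w : R -> R) : Prop :=
  forall eta : R, 0 < eta ->
    ex_derive_n u 2 eta /\ ex_derive_n w 2 eta /\
    (c1 ^ 2 - v ^ 2) * Derive_n u 2 eta - c3 ^ 2 * (u eta - w eta) = 0 /\
    (c2 ^ 2 - v ^ 2) * Derive_n w 2 eta + c3 ^ 2 * (u eta - w eta) = 0.

Definition separated_equations (u w : R -> R) : Prop :=
  forall eta : R, eta < 0 ->
    ex_derive_n u 2 eta /\ ex_derive_n w 2 eta /\
    Derive_n u 2 eta = 0 /\ Derive_n w 2 eta = 0.

Definition bounded_at_p_infty (f : R -> R) : Prop :=
  exists M : R, Rbar_locally p_infty (fun x => Rabs (f x) <= M).

Definition bond_strain (u w : R -> R) (eta : R) : R := w eta - u eta.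

Record steady_splitting (c1 c2 c3 v Qstar P1 P2 : R) (u w : R -> R) : Prop := {
  splitting_C1_u : continuously_differentiable u;
  splitting_C1_w : continuously_differentiable w;
  splitting_bonded : bonded_equations c1 c2 c3 v u w;
  splitting_separated : separated_equations u w;
  splitting_bounded : bounded_at_p_infty (bond_strain u w);
  splitting_critical : bond_strain u w 0 = Qstar;
  splitting_force_1 : forall eta : R, eta < 0 -> c1 ^ 2 * Derive u eta = P1;
  splitting_force_2 : forall eta : R, eta < 0 -> c2 ^ 2 * Derive w eta = P2
}.

Definition nu (c1 c2 c3 v : R) : R :=
  c3 * sqrt ((c1 ^ 2 + c2 ^ 2 - 2 * v ^ 2) /
             ((c1 ^ 2 - v ^ 2) * (c2 ^ 2 - v ^ 2))).

Definition strain_at_infinity (c1 c2 v P1 P2 : R) : R :=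
  1 / (c1 ^ 2 + c2 ^ 2 - 2 * v ^ 2) *
  (P1 * (1 - v ^ 2 / c1 ^ 2) + P2 * (1 - v ^ 2 / c2 ^ 2)).

(* Main.v *)
(** The strain [Q = w - u] solves [Q'' = nu^2 Q] behind the splitting point, so
    boundedness removes the growing exponential: [Q' = - nu Q] there, which at
    the splitting point is the relation between the forces. The weighted sum
    [(c1^2 - v^2) u' + (c2^2 - v^2) w'] is conserved and [w' - u' = Q'] decays,
    which determines the common limit of [u'] and [w']. *)
Require Import Defs.
From Stdlib Require Import Reals Lra.
From Coquelicot Require Import Coquelicot.
Open Scope R_scope.

(** The mean value theorem asks only for continuity at the endpoint [a], so constancy reaches [a]
    itself. This matters at the splitting point, where the second derivatives may jump. *)
Lemma continuous_zero_derive_const (f : R -> R) (a : R) :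
  (forall x, a <= x -> continuous f x) ->
  (forall x, a < x -> is_derive f x 0) ->
  forall x, a <= x -> f x = f a.
Proof.
  intros Hc Hd x Hx.
  destruct (MVT_gen f a x (fun _ => 0)) as [c [_ Heq]].
  - intros y Hy. rewrite Rmin_left in Hy by lra. apply Hd; lra.
  - intros y Hy. rewrite Rmin_left in Hy by lra.
    apply continuity_pt_filterlim, Hc; lra.
  - lra.
Qed.

(** Carries the prescribed forces from [eta < 0] to the splitting point: the limit along the left
    neighbourhoods of [x0] is unique. *)
Lemma continuous_const_left (f : R -> R) (x0 l : R) :
  continuous f x0 -> (forall x, x < x0 -> f x = l) -> f x0 = l.
Proof.
  intros Hc Hl.
  apply (filterlim_locally_unique (F := at_left x0) f).
  - exact (filterlim_filter_le_1 _ (filter_le_within (F := locally x0) _) Hc).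
  - apply (filterlim_ext_loc (fun _ => l)).
    + exists (mkposreal 1 Rlt_0_1); intros y _ Hy; symmetry; now apply Hl.
    + apply filterlim_const.
Qed.

Lemma is_lim_exp_decay (nu : R) : 0 < nu ->
  is_lim (fun x => exp (- nu * x)) p_infty 0.
Proof.
  intros Hnu.
  apply (is_lim_comp exp (fun x => - nu * x) p_infty 0 m_infty).
  - apply is_lim_exp_m.
  - replace m_infty with (Rbar_mult (- nu) p_infty).
    + apply is_lim_scal_l, is_lim_id.
    + simpl. destruct (Rle_dec 0 (- nu)) as [H|H]; [exfalso; lra | reflexivity].
  - exists 0; intros; discriminate.
Qed.

(* [nu] may have either sign, covering both factors of [D^2 - nu^2 = (D - nu) (D + nu)]. *)
Lemma hyperbolic_first_integral (q : R -> R) (nu : R) :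
  continuously_differentiable q ->
  (forall x, 0 < x -> is_derive (Derive q) x (nu ^ 2 * q x)) ->
  forall x, 0 <= x ->
  Derive q x + nu * q x = (Derive q 0 + nu * q 0) * exp (nu * x).
Proof.
  intros Hq Hode x Hx.
  assert (Hqd : forall y, is_derive q y (Derive q y)).
  { intros y; apply Derive_correct, Hq. }
  assert (Hed : forall y, is_derive (fun t => exp (- nu * t)) y (- nu * exp (- nu * y))).
  { intros y; auto_derive; [easy | ring]. }
  (* Integrating factor: [p = q' + nu * q] satisfies [p' = nu * p], so [p * exp (- nu * x)] has zero
     derivative for [x > 0]. *)
  assert (H : (Derive q x + nu * q x) * exp (- nu * x)
              = (Derive q 0 + nu * q 0) * exp (- nu * 0)).
  { apply (continuous_zero_derive_const
      (fun t => (Derive q t + nu * q t) * exp (- nu * t)) 0); trivial.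
    - intros y _.
      apply (continuous_mult (fun t => Derive q t + nu * q t)).
      + apply (continuous_plus (Derive q) (fun t => nu * q t)).
        * apply Hq.
        * apply (continuous_scal_r nu q), (ex_derive_continuous q), Hq.
      + apply (ex_derive_continuous (K := R_AbsRing) (V := R_NormedModule)
                 (fun t => exp (- nu * t))). now eexists.
    - intros y Hy.
      replace 0 with ((nu ^ 2 * q y + nu * Derive q y) * exp (- nu * y)
                      + (Derive q y + nu * q y) * (- nu * exp (- nu * y))) by ring.
      apply (is_derive_mult (fun t => Derive q t + nu * q t) (fun t => exp (- nu * t))
               y (nu ^ 2 * q y + nu * Derive q y) (- nu * exp (- nu * y))).
      + apply (is_derive_plus (Derive q) (fun t => nu * q t)).
        * now apply Hode.
        * apply (is_derive_scal q), Hqd.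
      + apply Hed.
      + exact Rmult_comm. }
  rewrite Rmult_0_r, exp_0, Rmult_1_r in H.
  rewrite <- H, Rmult_assoc, <- exp_plus.
  replace (- nu * x + nu * x) with 0 by ring.
  rewrite exp_0; ring.
Qed.

(** Eliminating [q'] between the two first integrals leaves [2 * nu * q = p0 * exp (nu * x) - m0 *
    exp (- nu * x)], so a bound on [q] alone, with none on [q'], forces [p0 = 0]. *)
Lemma bounded_hyperbolic_solution (q : R -> R) (nu : R) :
  0 < nu -> continuously_differentiable q ->
  (forall x, 0 < x -> is_derive (Derive q) x (nu ^ 2 * q x)) ->
  bounded_at_p_infty q ->
  Derive q 0 = - nu * q 0 /\ is_lim (Derive q) p_infty 0.
Proof.
  intros Hnu Hq Hode [M [A HM]].
  set (p0 := Derive q 0 + nu * q 0).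
  set (m0 := Derive q 0 + - nu * q 0).
  assert (Hp : forall x, 0 <= x -> Derive q x + nu * q x = p0 * exp (nu * x)).
  { now apply hyperbolic_first_integral. }
  assert (Hm : forall x, 0 <= x -> Derive q x + - nu * q x = m0 * exp (- nu * x)).
  { apply hyperbolic_first_integral; trivial.
    intros x Hx. replace ((- nu) ^ 2) with (nu ^ 2) by ring. auto. }
  assert (Hp0 : p0 = 0).
  (* Solving that relation for [p0] and using [exp (- nu * x) <= 1] once gives [|p0| <= (2 * nu * M
     + |m0|) * exp (- nu * x)] for large [x]; the right side tends to 0. *)
  { assert (Hle : Rbar_le (Rabs p0) (Rbar_mult (2 * nu * M + Rabs m0) 0)).
    { apply (is_lim_le_loc (fun _ => Rabs p0)
        (fun x => (2 * nu * M + Rabs m0) * exp (- nu * x)) p_infty).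
      - exists (Rmax 0 A); intros x Hx.
        assert (Hx0 : 0 < x) by (eapply Rle_lt_trans; [apply Rmax_l | eassumption]).
        assert (HxA : A < x) by (eapply Rle_lt_trans; [apply Rmax_r | eassumption]).
        specialize (HM x HxA).
        specialize (Hp x (Rlt_le _ _ Hx0)); specialize (Hm x (Rlt_le _ _ Hx0)).
        assert (He : exp (nu * x) * exp (- nu * x) = 1).
        { rewrite <- exp_plus. replace (nu * x + - nu * x) with 0 by ring. apply exp_0. }
        assert (Hpos := exp_pos (- nu * x)).
        assert (He1 : exp (- nu * x) <= 1).
        { rewrite <- exp_0. apply Rlt_le, exp_increasing. nra. }
        replace p0 with ((2 * nu * q x + m0 * exp (- nu * x)) * exp (- nu * x)).
        + rewrite Rabs_mult, (Rabs_pos_eq (exp _)) by lra.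
          apply Rmult_le_compat_r; [lra |].
          eapply Rle_trans; [apply Rabs_triang |].
          rewrite !Rabs_mult, (Rabs_pos_eq (exp _)), (Rabs_pos_eq 2), (Rabs_pos_eq nu) by lra.
          assert (H0 := Rabs_pos m0). nra.
        + replace (2 * nu * q x + m0 * exp (- nu * x)) with (p0 * exp (nu * x)) by lra.
          rewrite Rmult_assoc, He; ring.
      - apply is_lim_const.
      - apply is_lim_scal_l, is_lim_exp_decay, Hnu. }
    simpl in Hle. rewrite Rmult_0_r in Hle.
    assert (H0 := Rabs_pos p0).
    apply Rabs_eq_0; lra. }
  split.
  - unfold p0 in Hp0; lra.
  (* Adding the two first integrals with [p0 = 0] gives [2 * q' = m0 * exp (- nu * x)]. *)
  - apply (is_lim_ext_loc (fun x => m0 / 2 * exp (- nu * x))).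
    + exists 0; intros x Hx.
      specialize (Hp x (Rlt_le _ _ Hx)); specialize (Hm x (Rlt_le _ _ Hx)).
      rewrite Hp0 in Hp; lra.
    + replace (Finite 0) with (Rbar_mult (m0 / 2) 0) by (simpl; f_equal; ring).
      apply is_lim_scal_l, is_lim_exp_decay, Hnu.
Qed.

(** The sum on the right is the coefficient of [Q] obtained by dividing each string equation by its
    leading factor and subtracting. *)
Lemma nu_spec (c1 c2 c3 v : R) :
  0 < c3 -> 0 < c1 ^ 2 - v ^ 2 -> 0 < c2 ^ 2 - v ^ 2 ->
  0 < nu c1 c2 c3 v /\
  nu c1 c2 c3 v ^ 2 = c3 ^ 2 / (c1 ^ 2 - v ^ 2) + c3 ^ 2 / (c2 ^ 2 - v ^ 2).
Proof.
  intros H3 Ha Hb. unfold nu.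
  assert (Hr : 0 < (c1 ^ 2 + c2 ^ 2 - 2 * v ^ 2) / ((c1 ^ 2 - v ^ 2) * (c2 ^ 2 - v ^ 2))).
  { apply Rdiv_lt_0_compat; nra. }
  split.
  - apply Rmult_lt_0_compat; [easy | now apply sqrt_lt_R0].
  - rewrite Rpow_mult_distr, pow2_sqrt by lra. field; lra.
Qed.

Theorem mainTheorem1 (c1 c2 c3 v Qstar P1 P2 : R) (u w : R -> R)
  (hc12 : c2 <= c1) (hc2 : 0 < c2) (hc3 : 0 < c3)
  (hv0 : 0 <= v) (hv : v < c2) (hQ : 0 < Qstar)
  (huw : steady_splitting c1 c2 c3 v Qstar P1 P2 u w) :
  P1 / c1 ^ 2 - P2 / c2 ^ 2 = nu c1 c2 c3 v * Qstar /\
  is_lim (Derive u) p_infty (Finite (strain_at_infinity c1 c2 v P1 P2)) /\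
  is_lim (Derive w) p_infty (Finite (strain_at_infinity c1 c2 v P1 P2)).
Proof.
  destruct huw as [Hu Hw Hbond _ Hbd Hcrit HP1 HP2].
  assert (Ha : 0 < c1 ^ 2 - v ^ 2) by nra.
  assert (Hb : 0 < c2 ^ 2 - v ^ 2) by nra.
  destruct (nu_spec c1 c2 c3 v hc3 Ha Hb) as [Hnu Hnu2].
  assert (Hu0 : Derive u 0 = P1 / c1 ^ 2).
  { apply continuous_const_left; [apply Hu |].
    intros x Hx. rewrite <- (HP1 x Hx). field; lra. }
  assert (Hw0 : Derive w 0 = P2 / c2 ^ 2).
  { apply continuous_const_left; [apply Hw |].
    intros x Hx. rewrite <- (HP2 x Hx). field; lra. }
  assert (HdQ : forall x, Derive (bond_strain u w) x = Derive w x - Derive u x).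
  { intros x. apply Derive_minus; [apply Hw | apply Hu]. }
  assert (Hu2 : forall x, 0 < x ->
    is_derive (Derive u) x (- (c3 ^ 2 / (c1 ^ 2 - v ^ 2)) * bond_strain u w x)).
  { intros x Hx. destruct (Hbond x Hx) as (Eu & _ & Equ & _).
    replace (- (c3 ^ 2 / (c1 ^ 2 - v ^ 2)) * bond_strain u w x) with (Derive_n u 2 x).
    - now apply Derive_correct.
    - apply (Rmult_eq_reg_l (c1 ^ 2 - v ^ 2)); [| lra].
      rewrite (Rminus_diag_uniq _ _ Equ). unfold bond_strain. field; lra. }
  assert (Hw2 : forall x, 0 < x ->
    is_derive (Derive w) x (c3 ^ 2 / (c2 ^ 2 - v ^ 2) * bond_strain u w x)).
  { intros x Hx. destruct (Hbond x Hx) as (_ & Ew & _ & Eqw).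
    replace (c3 ^ 2 / (c2 ^ 2 - v ^ 2) * bond_strain u w x) with (Derive_n w 2 x).
    - now apply Derive_correct.
    - apply (Rmult_eq_reg_l (c2 ^ 2 - v ^ 2)); [| lra].
      rewrite (Rplus_opp_r_uniq _ _ (eq_trans (Rplus_comm _ _) Eqw)).
      unfold bond_strain. field; lra. }
  destruct (bounded_hyperbolic_solution (bond_strain u w) (nu c1 c2 c3 v)) as [HQ0 HQlim];
    trivial.
  { intros x; split.
    - apply (ex_derive_minus w u); [apply Hw | apply Hu].
    - apply (continuous_ext (fun x => Derive w x - Derive u x)).
      + intros y; symmetry; apply HdQ.
      + apply (continuous_minus (Derive w) (Derive u)); [apply Hw | apply Hu]. }
  { intros x Hx.
    apply (is_derive_ext (fun y => Derive w y - Derive u y)).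
    - intros y; symmetry; apply HdQ.
    - replace (nu c1 c2 c3 v ^ 2 * bond_strain u w x)
        with (c3 ^ 2 / (c2 ^ 2 - v ^ 2) * bond_strain u w x
              - - (c3 ^ 2 / (c1 ^ 2 - v ^ 2)) * bond_strain u w x)
        by (rewrite Hnu2; ring).
      apply (is_derive_minus (Derive w) (Derive u)); auto. }
  (* The decay condition [Q'(0) = - nu * Q(0)] becomes the relation between the forces. *)
  rewrite HdQ, Hu0, Hw0, Hcrit in HQ0.
  (* The bonds pull the two strings with opposite forces, which cancel in the weighted sum. *)
  assert (Hcons : forall x, 0 <= x ->
    (c1 ^ 2 - v ^ 2) * Derive u x + (c2 ^ 2 - v ^ 2) * Derive w x
    = (c1 ^ 2 - v ^ 2) * Derive u 0 + (c2 ^ 2 - v ^ 2) * Derive w 0).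
  { apply (continuous_zero_derive_const
      (fun x => (c1 ^ 2 - v ^ 2) * Derive u x + (c2 ^ 2 - v ^ 2) * Derive w x)).
    - intros x _.
      apply (continuous_plus (fun x => (c1 ^ 2 - v ^ 2) * Derive u x)).
      + apply (continuous_scal_r (c1 ^ 2 - v ^ 2) (Derive u)), Hu.
      + apply (continuous_scal_r (c2 ^ 2 - v ^ 2) (Derive w)), Hw.
    - intros x Hx.
      replace 0 with
        ((c1 ^ 2 - v ^ 2) * (- (c3 ^ 2 / (c1 ^ 2 - v ^ 2)) * bond_strain u w x)
         + (c2 ^ 2 - v ^ 2) * (c3 ^ 2 / (c2 ^ 2 - v ^ 2) * bond_strain u w x))
        by (field; lra).
      apply (is_derive_plus (fun x => (c1 ^ 2 - v ^ 2) * Derive u x));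
        apply is_derive_scal; auto. }
  (* At the splitting point each term of the conserved sum is [(c ^ 2 - v ^ 2) * P / c ^ 2 = P * (1
     - v ^ 2 / c ^ 2)]. *)
  assert (HA : ((c1 ^ 2 - v ^ 2) * Derive u 0 + (c2 ^ 2 - v ^ 2) * Derive w 0)
               / (c1 ^ 2 + c2 ^ 2 - 2 * v ^ 2) = strain_at_infinity c1 c2 v P1 P2).
  { rewrite Hu0, Hw0. unfold strain_at_infinity. field. repeat split; lra. }
  set (A := strain_at_infinity c1 c2 v P1 P2) in *.
  (* Solving the conserved sum and [w' - u' = Q'] for [u'] and [w']. *)
  assert (Hlim : forall (k : R) (f : R -> R),
    (forall x, 0 < x -> f x = A + k * Derive (bond_strain u w) x) ->
    is_lim f p_infty A).
  { intros k f Hf.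
    apply (is_lim_ext_loc (fun x => A + k * Derive (bond_strain u w) x)).
    - exists 0; intros x Hx; symmetry; auto.
    - replace (Finite A) with (Finite (A + k * 0)) by (f_equal; ring).
      apply (is_lim_plus' (fun _ => A)); [apply is_lim_const |].
      exact (is_lim_scal_l _ k p_infty 0 HQlim). }
  split; [lra | split].
  (* With [a = c1 ^ 2 - v ^ 2] and [b = c2 ^ 2 - v ^ 2], the weighted mean of [u'] and [w'] is [A],
     hence [u' = A - b / (a + b) * Q'] and [w' = A + a / (a + b) * Q']. *)
  - apply (Hlim (- (c2 ^ 2 - v ^ 2) / (c1 ^ 2 + c2 ^ 2 - 2 * v ^ 2))).
    intros x Hx. rewrite <- HA, <- (Hcons x), HdQ by lra. field; lra.
  - apply (Hlim ((c1 ^ 2 - v ^ 2) / (c1 ^ 2 + c2 ^ 2 - 2 * v ^ 2))).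
    intros x Hx. rewrite <- HA, <- (Hcons x), HdQ by lra. field; lra.
Qed.
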